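(* There exists a constant $c>0$ depending only on $n$ and $s$ such that the following holds. Let $\Omega\subset\mathbb{R}^n$ be bounded and let $E$ be a variational subsolution in $\Omega$. If $x\in\partial E$, $r>0$ and $B_r(x)\cap E\subset\Omega$, then $$|E\cap B_r(x)|\ge c\,r^n.$$
   Context: Fix $n\ge1$ and $0<s<1$. All sets are Lebesgue measurable; $\mathcal{C}A=\mathbb{R}^n\setminus A$; $|\cdot|$ is Lebesgue measure. For $A,B\subset\mathbb{R}^n$, $L(A,B):=\int\int\frac{\chi_A(x)\chi_B(y)}{|x-y|^{n+s}}\,dx\,dy\in[0,\infty]$. A set $E\subset\mathbb{R}^n$ is a variational subsolution in $\Omega$ if for every $A\subset E\cap\Omega$ one has $L(A,E\setminus A)-L(A,\mathcal{C}E)\ge0$, i.e. $L(A,\mathcal{C}E)\le L(A,E\setminus A)$. Convention: sets are modified on a null set so that they contain their measure-theoretic interior (points $x$ with $|B_r(x)\setminus E|=0$ for some $r>0$) and do not meet the measure-theoretic interior of their complement; thus $x\in\partial E$ if and only if $|B_r(x)\cap E|>0$ and $|B_r(x)\cap\mathcal{C}E|>0$ for all $r>0$. *)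

(* Defs.v *)
From HB Require Import structures.
From mathcomp Require Import all_boot all_order all_algebra.
From mathcomp Require Import all_classical all_reals all_analysis.

Set Implicit Arguments.
Unset Strict Implicit.
Unset Printing Implicit Defensive.

Import Order.TTheory GRing.Theory Num.Theory.
Import numFieldNormedType.Exports.

Local Open Scope classical_set_scope.
Local Open Scope ring_scope.

(* Borel sigma-algebra of R^n: generated by the coordinate maps, as the library
   does for n.-tuple. *)
Section borel_rV.
Context {R : realType} {n : nat}.

Let coords (i : 'I_n) (x : 'rV[R]_n) : measurableTypeR R := x ord0 i.

Let rV_set0 : g_sigma_preimage coords set0.
Proof. exact: sigma_algebra0. Qed.

Let rV_setC A : g_sigma_preimage coords A -> g_sigma_preimage coords (~` A).
Proof. exact: sigma_algebraC. Qed.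

Let rV_bigcup (F : _^nat) : (forall i, g_sigma_preimage coords (F i)) ->
  g_sigma_preimage coords (\bigcup_i (F i)).
Proof. exact: sigma_algebra_bigcup. Qed.

HB.instance Definition _ := @isMeasurable.Build default_measure_display
  'rV[R]_n (g_sigma_preimage coords) rV_set0 rV_setC rV_bigcup.

Lemma measurable_coord_rV (i : 'I_n) :
  measurable_fun [set: 'rV[R]_n] (coords i).
Proof.
move=> _ Y mY; rewrite setTI; apply: sub_sigma_algebra => /=.
rewrite -bigcup_seq/=; exists i => /=; first by rewrite mem_index_enum.
by exists Y => //; rewrite setTI.
Qed.

Lemma measurable_fun_rV d (T : measurableType d) (f : T -> 'rV[R]_n) :
  (forall i, measurable_fun [set: T] (coords i \o f)) ->
  measurable_fun [set: T] f.
Proof.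
move=> mf.
suff prefS : g_sigma_preimage (fun i => coords i \o f) `<=` measurable.
  move=> _ A mA; apply: prefS; rewrite g_sigma_preimage_comp.
  by exists A.
apply: smallest_sub; first exact: sigma_algebra_measurable.
rewrite -bigcup_seq/=; apply: bigcup_sub => i _.
by move=> A [B mB <-]; exact: mf.
Qed.

End borel_rV.

(* Lebesgue measure on the Borel sets of R^n, by induction on n:
   a point mass on R^0, and the product lambda^1 x lambda^n on R^(n+1). *)
Section borel_lebesgue.
Context {R : realType}.

Definition cons_rV n (p : measurableTypeR R * 'rV[R]_n) : 'rV[R]_n.+1 :=
  \row_i oapp (fun j => p.2 ord0 j) p.1 (unlift ord0 i).

Let uncons_rV n (x : 'rV[R]_n.+1) : measurableTypeR R * 'rV[R]_n :=
  (x ord0 ord0, \row_j x ord0 (lift ord0 j)).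

Lemma measurable_cons_rV n : measurable_fun setT (@cons_rV n).
Proof.
apply: measurable_fun_rV => i.
rewrite (_ : _ \o _ = fun p : measurableTypeR R * 'rV[R]_n =>
    oapp (fun j => p.2 ord0 j) p.1 (unlift ord0 i)); last first.
  by apply/funext => p /=; rewrite mxE.
case: unliftP => [j _|_] /=; last exact: measurable_fst.
apply: (measurableT_comp (@measurable_coord_rV R n j)).
exact: measurable_snd.
Qed.

Let measurable_uncons_rV n : measurable_fun setT (@uncons_rV n).
Proof.
apply/measurable_fun_pairP; split => /=.
  exact: (@measurable_coord_rV R n.+1 ord0).
apply: measurable_fun_rV => j.
rewrite (_ : _ \o _ = fun x : 'rV[R]_n.+1 => x ord0 (lift ord0 j)); last first.
  by apply/funext => x /=; rewrite mxE.
exact: (@measurable_coord_rV R n.+1 (lift ord0 j)).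
Qed.

Let cons_rVK n : cancel (@cons_rV n) (@uncons_rV n).
Proof.
case=> t v; rewrite /uncons_rV /cons_rV; congr pair.
  by rewrite mxE unlift_none.
by apply/rowP => j; rewrite !mxE liftK.
Qed.

Section step.
Variables (n : nat) (mu : {sigma_finite_measure set 'rV[R]_n -> \bar R}).

Definition cons_measure : set 'rV[R]_n.+1 -> \bar R :=
  pushforward (lebesgue_measure \x mu)%E (@cons_rV n).

Let cons_measure0 : cons_measure set0 = 0%E.
Proof. by rewrite /cons_measure /pushforward preimage_set0 measure0. Qed.

Let cons_measure_ge0 A : (0 <= cons_measure A)%E.
Proof. by rewrite /cons_measure /pushforward measure_ge0. Qed.

Let cons_measure_sigma_additive : semi_sigma_additive cons_measure.
Proof.
exact: (@measure_semi_sigma_additive _ _ _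
  (measure_function_pushforward__canonical__measure_function_Measure
   (lebesgue_measure \x mu)%E (@measurable_cons_rV n))).
Qed.

HB.instance Definition _ := isMeasure.Build _ _ _
  cons_measure cons_measure0 cons_measure_ge0 cons_measure_sigma_additive.

Let cons_measure_sigma_finite : sigma_finite setT cons_measure.
Proof.
have /sigma_finiteP[F [TF ndF Foo]] := sigma_finiteT (@lebesgue_measure R).
have /sigma_finiteP[G [TG ndG Goo]] := sigma_finiteT mu.
exists (fun k => @uncons_rV n @^-1` (F k `*` G k)).
  rewrite -preimage_bigcup; apply/esym/seteqP; split => // x _.
  have [k _ Fk] : (\bigcup_k F k) (uncons_rV x).1 by rewrite -TF.
  have [l _ Gl] : (\bigcup_k G k) (uncons_rV x).2 by rewrite -TG.
  exists (maxn k l) => //; split.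
    exact: (subsetPset _ _ (ndF _ _ (leq_maxl k l))).
  exact: (subsetPset _ _ (ndG _ _ (leq_maxr k l))).
move=> k; have [mF Fk] := Foo k; have [mG Gk] := Goo k; split.
  rewrite -[X in measurable X]setTI; apply: measurable_uncons_rV => //.
  exact: measurableX.
rewrite /cons_measure /pushforward -comp_preimage.
rewrite (_ : _ \o _ = id); last by apply/funext => p; exact: cons_rVK.
by rewrite preimage_id product_measure1E// lte_mul_pinfty// ge0_fin_numE.
Qed.

HB.instance Definition _ := Measure_isSigmaFinite.Build _ _ _
  cons_measure cons_measure_sigma_finite.

End step.

Fixpoint borel_lebesgue_rV n : {sigma_finite_measure set 'rV[R]_n -> \bar R} :=
  match n return {sigma_finite_measure set 'rV[R]_n -> \bar R} with
  | 0 => dirac (0 : 'rV[R]_0)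
  | m.+1 => cons_measure (borel_lebesgue_rV m)
  end.

Lemma borel_lebesgue_rV_box n (A : 'I_n -> set (measurableTypeR R)) :
  (forall i, measurable (A i)) ->
  borel_lebesgue_rV n [set x | forall i, A i (x ord0 i)] =
  (\prod_(i < n) lebesgue_measure (A i))%E.
Proof.
elim: n A => [|n IH] A mA.
  rewrite big_ord0 /= diracE mem_set//=.
  by move=> [].
rewrite big_ord_recl /= /cons_measure /pushforward.
set B := [set x : 'rV[R]_n | forall i, A (lift ord0 i) (x ord0 i)].
have mB : measurable B.
  rewrite (_ : B = \big[setI/setT]_(i < n)
     ((fun x : 'rV[R]_n => x ord0 i) @^-1` A (lift ord0 i))).
    apply: bigsetI_measurable => i _ /=; rewrite -[X in measurable X]setTI.
    exact: (@measurable_coord_rV R n i).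
  rewrite -bigcap_seq; apply/seteqP; split => x /= Bx i.
    by move=> _; exact: Bx.
  by apply: Bx; rewrite /= mem_index_enum.
rewrite (_ : _ @^-1` _ = A ord0 `*` B); last first.
  apply/seteqP; split => [[t v] /= H|[t v] /= [H0 H] i].
    split; first by have := H ord0; rewrite mxE unlift_none.
    by move=> i; have := H (lift ord0 i); rewrite mxE liftK.
  by rewrite mxE; case: unliftP => [j ->|->] /=.
by rewrite product_measure1E// -(IH (fun i => A (lift ord0 i))).
Qed.

End borel_lebesgue.

(* The Lebesgue sigma-algebra: Caratheodory-measurable sets for the outer
   measure induced by the Borel measure. *)
Definition lebesgue_measurable (R : realType) (n : nat) : set (set 'rV[R]_n) :=
  (@borel_lebesgue_rV R n)^*%mu.-cara.-measurable.

Definition lebesgue_rV (R : realType) (n : nat) :=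
  @completed_measure_extension _ _ _ (@borel_lebesgue_rV R n).
HB.instance Definition _ (R : realType) (n : nat) :=
  Measure.on (@lebesgue_rV R n).

Section fractional.
Context {R : realType} {n : nat}.
Implicit Types (A B E Omega : set 'rV[R]_n) (x y : 'rV[R]_n).

(* The library norm on 'rV[R]_n is the sup norm. *)
Definition enorm x : R := Num.sqrt (\sum_(i < n) x ord0 i ^+ 2).

Definition eball x (r : R) : set 'rV[R]_n := [set y | enorm (y - x) < r].

(* At x = y the library quotient is 0 instead of +oo; for n >= 1 the diagonal
   is a null set. *)
Definition interaction (s : R) A B : \bar R :=
  (\int[@lebesgue_rV R n]_y \int[@lebesgue_rV R n]_x
     (\1_A x * \1_B y / enorm (x - y) `^ (n%:R + s))%:E)%E.

Definition variational_subsolution (s : R) Omega E : Prop :=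
  forall A, lebesgue_measurable A -> A `<=` E `&` Omega ->
    (interaction s A (~` E) <= interaction s A (E `\` A))%E.

(* Measure-theoretic interior, and the choice of representative which makes the
   topological boundary of E the set of points all of whose balls meet E and
   its complement in positive measure. *)
Definition mt_interior E : set 'rV[R]_n :=
  [set x | exists2 r : R, 0 < r & lebesgue_rV (eball x r `\` E) = 0%E].

Definition mt_normalized E : Prop :=
  mt_interior E `<=` E /\ mt_interior (~` E) `&` E = set0.

Definition boundary E : set 'rV[R]_n := closure E `\` E°.

End fractional.

(* Main.v *)
(* Work with cubes Q_t around x (sup norm) of half-side t, V(t) = |E \cap Q_t|
   and A_t = E \cap Q_t.  The subsolution property gives
   L(A_t, C A_t) <= 2 L(A_t, E \ A_t) <= 2 L(A_t, C Q_t).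
   - If |A_t| is at most half the volume of a cube of half-side h, then around
     every point of A_t half of such a cube lies in C A_t, so
     L(A_t, C A_t) >= c h^-s |A_t|.
   - Integrating L(A_t, C Q_t) over t in ]a, b[ (Tonelli) replaces the kernel by
     min(|x - y|, b - a) |x - y|^-(n + s), whose integral in y is at most
     C (b - a)^(1 - s), by summation over dyadic shells.
   With h = eta (b - a) this yields V(a) <= C' eta^s V(b), a linear decay: for
   small eta, V(a) <= 2^-n V(b) as soon as V(b) <= (2 eta (b - a))^n / 2.  This
   smallness is reproduced at the next scale along radii with b - a halved at
   each step, so a small density at scale r forces V to vanish at scale r / 2n,
   against x being a boundary point of the normalized set E. *)

Require Import Defs.
From HB Require Import structures.
From mathcomp Require Import all_boot all_order all_algebra.
From mathcomp Require Import all_classical all_reals all_analysis.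
From mathcomp Require Import measurable_realfun ring lra.

Set Implicit Arguments.
Unset Strict Implicit.
Unset Printing Implicit Defensive.

Import Order.TTheory GRing.Theory Num.Theory.
Import numFieldNormedType.Exports.

Local Open Scope classical_set_scope.
Local Open Scope ring_scope.

(** * Averaging the energy inequality over a range of radii *)

Lemma measurable_natr_bool d (T : measurableType d) (R : realType)
    (f : T -> bool) :
  measurable_fun setT f -> measurable_fun setT (fun x => (f x)%:R : R).
Proof.
move=> mf.
rewrite (_ : (fun _ => _) = fun x => if f x then 1%R else 0%R); last first.
  by apply/funext => x; case: (f x).
exact: measurable_fun_ifT.
Qed.

Lemma integral_ge0_EFin d (T : measurableType d) (R : realType)
    (mu : {measure set T -> \bar R}) (f : T -> R) :
  (forall x, 0 <= f x) -> (0 <= \int[mu]_x (f x)%:E)%E.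
Proof. by move=> f0; apply: integral_ge0 => x _; rewrite lee_fin. Qed.

(** With [u = N x] and [v = N y] this measures the radii [t] that separate [x] from [y]. They lie
    both in []a, b[] and in []u, v]], so either length is a bound; [Num.max] covers an empty []u,
    v]]. *)
Lemma integral_between_le (R : realType) (a b u v : R) : a < b ->
  (\int[lebesgue_measure]_t
     (((a < t < b) && (u < t <= v))%:R : R)%:E <=
   (Num.min (b - a) (Num.max 0 (v - u)))%:E)%E.
Proof.
move=> ab.
set S := `]a, b[%classic `&` `]u, v]%classic.
have mS : measurable S by exact: measurableI.
have -> : (\int[lebesgue_measure]_t
     (((a < t < b) && (u < t <= v))%:R : R)%:E =
   \int[lebesgue_measure]_t (\1_S t)%:E)%E.
  apply: eq_integral => t _; rewrite indicE; congr (_%:R%:E); congr nat_of_bool.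
  apply/idP/idP.
    by move=> /andP[h1 h2]; rewrite inE /S; split; rewrite /= in_itv/=.
  by rewrite inE /S => -[]; rewrite /= !in_itv/= => -> ->.
rewrite integral_indic// setIT EFin_min lexI; apply/andP; split.
  apply: (@le_trans _ _ (lebesgue_measure `]a, b[%classic)).
    by apply: le_measure; rewrite ?inE//; exact: subIsetl.
  by rewrite lebesgue_measure_itv/= lte_fin ab.
apply: (@le_trans _ _ (lebesgue_measure `]u, v]%classic)).
  by apply: le_measure; rewrite ?inE//; exact: subIsetr.
rewrite lebesgue_measure_itv/= lte_fin; case: ltP => uv.
  by rewrite -EFinB lee_fin le_max lexx orbT.
by rewrite lee_fin le_max lexx.
Qed.

Lemma measurable_indic_comp d d' (T : measurableType d) (T' : measurableType d')
    (R : realType) (A : set T) (f : T' -> T) :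
  measurable A -> measurable_fun setT f ->
  measurable_fun setT (fun z => \1_A (f z) : R).
Proof.
move=> mA mf; apply: measurableT_comp => //.
Qed.

Section averaging.
Local Open Scope ereal_scope.
Context d (T : measurableType d) (R : realType).
Variable mu : {sigma_finite_measure set T -> \bar R}.
Variables (K : T * T -> R) (N : T -> R) (E : set T).
Hypotheses (mK : measurable_fun setT K) (K0 : forall z, (0 <= K z)%R).
Hypotheses (mN : measurable_fun setT N) (mE : measurable E).

Let I (A B : set T) :=
  \int[mu]_y \int[mu]_x (\1_A x * \1_B y * K (x, y))%:E.

Let sub (t : R) := E `&` [set x | (N x < t)%R].

Let msub t : measurable (sub t).
Proof.
apply: measurableI => //.
by rewrite -preimage_itvNyo -[X in measurable X]setTI; exact: mN.
Qed.

Let mIK (A B : set T) : measurable A -> measurable B ->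
  measurable_fun setT (fun z : T * T => (\1_A z.1 * \1_B z.2 * K z)%:E).
Proof.
move=> mA mB; apply/measurable_EFinP; apply: measurable_funM => //.
apply: measurable_funM.
  by apply: measurable_indic_comp => //; exact: measurable_fst.
by apply: measurable_indic_comp => //; exact: measurable_snd.
Qed.

Let IK0 (A B : set T) x y : (0 <= \1_A x * \1_B y * K (x, y))%R.
Proof. by rewrite !mulr_ge0. Qed.

Let IK0E (A B : set T) z : 0 <= (\1_A z.1 * \1_B z.2 * K z)%:E.
Proof. by rewrite lee_fin !mulr_ge0. Qed.

Let I_inner (A B : set T) : measurable A -> measurable B -> measurable_fun setT
  (fun y => \int[mu]_x (\1_A x * \1_B y * K (x, y))%:E).
Proof.
move=> mA mB.
exact: (measurable_fun_fubini_tonelli_G (m1 := mu) _ (mIK mA mB)).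
Qed.

Let I_le (A B C D : set T) :
  measurable A -> measurable B -> measurable C -> measurable D ->
  A `<=` C -> B `<=` D -> I A B <= I C D.
Proof.
move=> mA mB mC mD AC BD; apply: ge0_le_integral => //.
- by move=> y _; exact: integral_ge0_EFin.
- exact: I_inner.
- exact: I_inner.
move=> y _; apply: ge0_le_integral => //.
- by move=> x _; rewrite lee_fin.
- exact: (measurableT_comp (mIK mA mB) (pair2_measurable y)).
- exact: (measurableT_comp (mIK mC mD) (pair2_measurable y)).
move=> x _; rewrite lee_fin; apply: ler_wpM2r => //.
apply: ler_pM => //; rewrite !indicE ler_nat.
  by case: (boolP (x \in A)) => //; rewrite !inE => /AC/mem_set->.
by case: (boolP (y \in B)) => //; rewrite !inE => /BD/mem_set->.
Qed.

Let I_setU (A B C : set T) : measurable A -> measurable B -> measurable C ->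
  B `&` C = set0 -> I A (B `|` C) = I A B + I A C.
Proof.
move=> mA mB mC BC0; rewrite /I -ge0_integralD//; last 4 first.
- by move=> y _; exact: integral_ge0_EFin.
- exact: I_inner.
- by move=> y _; exact: integral_ge0_EFin.
- exact: I_inner.
apply: eq_integral => y _; rewrite -ge0_integralD//; last 4 first.
- by move=> x _; rewrite lee_fin.
- exact: (measurableT_comp (mIK mA mB) (pair2_measurable y)).
- by move=> x _; rewrite lee_fin.
- exact: (measurableT_comp (mIK mA mC) (pair2_measurable y)).
apply: eq_integral => x _; rewrite -EFinD; congr EFin.
rewrite -mulrDl -mulrDr; congr (_ * _ * _)%R.
rewrite !indicE in_setU; have : ~~ ((y \in B) && (y \in C)).
  apply/negP => /andP[]; rewrite !inE => By Cy.
  by rewrite -[False]/(set0 y) -BC0.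
by case: (y \in B); case: (y \in C); rewrite //= ?addr0 ?add0r.
Qed.

(** By [low], [sub t] has energy at least [m * mu (sub t)] against its complement; by [Esub], at
    most twice its interaction with the rest of [E]. Integration in [t] weights each pair by the
    length of the radii between [N x] and [N y], which is at most [Num.min (b - a) (D x y)], and
    [up] bounds the result for each [x]. *)
Lemma averaged_energy_le (D : T -> T -> R) (a b m M : R) :
  (a < b)%R -> (0 <= m)%R -> (0 <= M)%R ->
  (forall x, measurable_fun setT (D x)) ->
  (forall x y, Num.max 0 (N y - N x) <= D x y)%R ->
  (forall t, (a < t < b)%R -> I (sub t) (~` E) <= I (sub t) (E `\` sub t)) ->
  (forall t, (a < t < b)%R -> forall x, sub t x ->
     m%:E <= \int[mu]_y (\1_(~` sub t) y * K (x, y))%:E) ->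
  (forall x, \int[mu]_y
     (Num.min (b - a) (D x y) * K (x, y))%:E <= M%:E) ->
  ((b - a) * m)%:E * mu (sub a) <= (2 * M)%:E * mu (sub b).
Proof.
move=> ab m0 M0 mD ND Esub low up.
have ba0 : (0 <= b - a)%R by rewrite subr_ge0 ltW.
(* Here [z] is [((t, x), y)]. Membership of [y] in [E] outside [sub t] is relaxed to [t <= N y], so
   that for fixed [x] the bound involves the kernel alone. *)
pose G (z : (measurableTypeR R * T) * T) : R :=
  ((((a < z.1.1 < b) && (N z.1.2 < z.1.1 <= N z.2))%:R
   * \1_E z.1.2) * K (z.1.2, z.2))%R.
have mG : measurable_fun setT G.
  have m11 : measurable_fun setT (fun z : (measurableTypeR R * T) * T => z.1.1).
    exact: (measurableT_comp measurable_fst measurable_fst).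
  have m12 : measurable_fun setT (fun z : (measurableTypeR R * T) * T => z.1.2).
    exact: (measurableT_comp measurable_snd measurable_fst).
  apply: measurable_funM.
    apply: measurable_funM.
      apply: measurable_natr_bool; apply: measurable_and; apply: measurable_and.
      - exact: measurable_fun_ltr.
      - exact: measurable_fun_ltr.
      - by apply: measurable_fun_ltr => //; exact: measurableT_comp.
      - by apply: measurable_fun_ler => //; exact: measurableT_comp.
    by apply: measurable_indic_comp => //; exact: m12.
  by apply: (measurableT_comp mK); exact: measurable_fun_pair.
have G0 z : (0 <= G z)%R by rewrite !mulr_ge0.
have mGE : measurable_fun setT (EFin \o G) by exact/measurable_EFinP.
have GE0 z : 0 <= (EFin \o G) z by rewrite lee_fin.
pose J p := \int[mu]_y (G (p, y))%:E.
have mJ : measurable_fun setT J.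
  exact: (measurable_fun_fubini_tonelli_F (m2 := mu) _ mGE GE0).
have J0 p : 0 <= J p by exact: integral_ge0_EFin.
(* Since [sub a] lies in every [sub t], the lower bound can be made independent of [t]. *)
have key t : (a < t < b)%R -> m%:E * mu (sub a) <= 2%:E * \int[mu]_x J (t, x).
  move=> tab; have /andP[at_ tb] := tab.
  have mCsub : measurable (~` sub t) by exact: measurableC.
  have mEt : measurable (E `\` sub t) by exact: measurableD.
  apply: (@le_trans _ _ (I (sub t) (~` sub t))).
    rewrite /I -(fubini_tonelli _ (mIK (msub t) mCsub))//.
    apply: (@le_trans _ _ (\int[mu]_x (m%:E * (\1_(sub t) x)%:E))).
      rewrite ge0_integralZl_EFin//; last exact/measurable_EFinP.
      rewrite integral_indic// setIT lee_wpmul2l//.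
      apply: le_measure; rewrite ?inE// => x [Ex xa]; split => //=.
      exact: lt_trans at_.
    apply: ge0_le_integral => //.
    - by move=> x _; rewrite -EFinM lee_fin mulr_ge0.
    - by apply/measurable_EFinP; apply: measurable_funM => //.
    - exact: (measurable_fun_fubini_tonelli_F (m2 := mu) _
        (mIK (msub t) mCsub)).
    move=> x _; rewrite [in leLHS]indicE.
    case: (boolP (x \in sub t)) => xt; last first.
      by rewrite mule0; exact: integral_ge0_EFin.
    rewrite mule1; apply: le_trans (low t tab x _) _.
      by rewrite inE in xt.
    by under [leRHS]eq_integral do rewrite [\1_(sub t) x]indicE xt mul1r.
  (* Source of the factor 2: of these two pieces, the first is controlled by the second through
     [Esub], and the second by [G]. *)
  have -> : ~` sub t = ~` E `|` (E `\` sub t).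
    apply/seteqP; split => y /=; rewrite /sub /=; last first.
      by move=> [nE [//]|[Ey h]].
    by have [Ey|nEy] := pselect (E y); [right|left].
  rewrite I_setU//; last 2 first.
  - exact: measurableC.
  - by apply/seteqP; split => // y [nE [/nE]].
  have mGt : measurable_fun setT (fun z : T * T => (G ((t, z.1), z.2))%:E).
    apply: (measurableT_comp mGE).
    by apply: measurable_fun_pair => //; apply: measurable_fun_pair.
  have mGt0 (z : T * T) : 0 <= (G ((t, z.1), z.2))%:E by rewrite lee_fin.
  rewrite (_ : \int[mu]_x J (t, x) = \int[mu]_y \int[mu]_x (G ((t, x), y))%:E);
    last exact: (fubini_tonelli _ mGt mGt0).
  have JI : I (sub t) (E `\` sub t) <= \int[mu]_y \int[mu]_x (G ((t, x), y))%:E.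
    apply: ge0_le_integral => //.
    - by move=> y _; exact: integral_ge0_EFin.
    - exact: I_inner.
    - exact: (measurable_fun_fubini_tonelli_G (m1 := mu) _ mGt mGt0).
    move=> y _; apply: ge0_le_integral => //.
    - by move=> x _; rewrite lee_fin.
    - exact: (measurableT_comp (mIK (msub t) mEt) (pair2_measurable y)).
    - exact: (measurableT_comp mGt (pair2_measurable y)).
    move=> x _; rewrite lee_fin /G /= tab /=; apply: ler_wpM2r => //.
    rewrite !indicE; case: (boolP (x \in sub t)) => [|_]; last first.
      by rewrite mul0r mulr_ge0.
    rewrite inE => -[Ex xt]; rewrite (mem_set Ex) mulr1 mul1r ler_nat xt /=.
    case: (boolP (y \in _)) => //; rewrite inE => -[Ey ny].
    by case: leP => // yt; exfalso; apply: ny; split.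
  have -> : 2%:E = 1%:E + 1%:E :> \bar R by rewrite -EFinD.
  rewrite ge0_muleDl// !mul1e; apply: leeD; last exact: JI.
  exact: le_trans (Esub t tab) JI.
have mJx : measurable_fun setT (fun t => \int[mu]_x J (t, x)).
  exact: (measurable_fun_fubini_tonelli_F (m2 := mu) _ mJ J0).
have Jx0 t : 0 <= \int[mu]_x J (t, x) by exact: integral_ge0.
have -> : ((b - a) * m)%:E * mu (sub a) =
    \int[lebesgue_measure]_(t in `]a, b[) (m%:E * mu (sub a)).
  rewrite integral_cst// EFinM -muleA muleC; congr (_ * _); apply/esym.
  by apply: etrans (lebesgue_measure_itv `]a, b[) _; rewrite /= lte_fin ab.
apply: (@le_trans _ _ (2%:E * \int[lebesgue_measure]_t \int[mu]_x J (t, x))).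
  rewrite -ge0_integralZl_EFin//.
  apply: (@le_trans _ _ (\int[lebesgue_measure]_(t in `]a, b[)
      (2%:E * \int[mu]_x J (t, x)))).
    apply: ge0_le_integral => //.
    - by move=> t _; rewrite mule_ge0.
    - by apply: measurable_funTS; exact: measurable_funeM.
  apply: ge0_subset_integral => //.
  - exact: measurable_funeM.
  - by move=> t _; rewrite mule_ge0.
rewrite EFinM -muleA lee_wpmul2l//.
(* With [x] as outer variable the bound can be proved point by point; points outside [sub b]
   contribute nothing, as [N x < t < b] fails for them. *)
rewrite (fubini_tonelli (m1 := lebesgue_measure) (m2 := mu) _ mJ J0).
have -> : M%:E * mu (sub b) = \int[mu]_x (M%:E * (\1_(sub b) x)%:E).
  rewrite ge0_integralZl_EFin//; last exact/measurable_EFinP.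
  by rewrite integral_indic// setIT.
apply: ge0_le_integral => //.
- by move=> x _; exact: integral_ge0.
- exact: (measurable_fun_fubini_tonelli_G (m1 := lebesgue_measure) _ mJ J0).
- by apply/measurable_EFinP; apply: measurable_funM.
move=> x _; rewrite indicE; case: (boolP (x \in sub b)) => xb; last first.
  rewrite mule0 integral0_eq// => t _; apply: integral0_eq => y _.
  rewrite /G /=; move: xb; rewrite notin_setE /sub /= => xb.
  rewrite indicE; case: (boolP (x \in E)); last by rewrite mulr0 mul0r.
  rewrite inE => Ex; rewrite (_ : _ && _ = false) ?mul0r//.
  apply/negP => /andP[/andP[_ tb] /andP[xt _]].
  by apply: xb; split => //; exact: lt_trans tb.
rewrite mule1; apply: le_trans (up x).
have mGx : measurable_fun setT
    (fun z : measurableTypeR R * T => (G ((z.1, x), z.2))%:E).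
  apply: (measurableT_comp mGE).
  by apply: measurable_fun_pair => //; apply: measurable_fun_pair.
have mGx0 (z : measurableTypeR R * T) : 0 <= (G ((z.1, x), z.2))%:E.
  by rewrite lee_fin.
(* A second exchange, at fixed [x], makes [t] the inner variable, where [integral_between_le]
   applies. *)
rewrite (fubini_tonelli (m1 := lebesgue_measure) (m2 := mu) _ mGx mGx0).
apply: ge0_le_integral => //.
- by move=> y _; exact: integral_ge0_EFin.
- exact: (measurable_fun_fubini_tonelli_G (m1 := lebesgue_measure) _ mGx mGx0).
- apply/measurable_EFinP; apply: measurable_funM.
    exact: measurable_minr.
  exact: (measurableT_comp mK (pair1_measurable x)).
move=> y _; have K0E : 0 <= (K (x, y))%:E by rewrite lee_fin.
apply: (@le_trans _ _
    (Num.min (b - a) (Num.max 0 (N y - N x)) * K (x, y))%:E); last first.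
  by rewrite lee_fin ler_wpM2r// le_min ge_min lexx/= ge_min ND orbT.
rewrite EFinM.
apply: le_trans (lee_wpmul2r K0E (integral_between_le (N x) (N y) ab)).
have mb : measurable_fun (setT : set (measurableTypeR R))
    (fun t => ((a < t < b) && (N x < t <= N y))%:R%:E : \bar R).
  apply/measurable_EFinP; apply: measurable_natr_bool.
  apply: measurable_and; apply: measurable_and;
    by do ?[exact: measurable_fun_ltr|exact: measurable_fun_ler].
rewrite -ge0_integralZr//.
apply: ge0_le_integral => //.
- exact: (measurableT_comp mGx (pair2_measurable y)).
- apply/measurable_EFinP; apply: measurable_funM => //.
  exact/measurable_EFinP.
move=> t _; rewrite -EFinM lee_fin /G /=; apply: ler_wpM2r => //.
by apply: ler_piMr => //; rewrite indicE lern1 leq_b1.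
Qed.
End averaging.

(** * Lebesgue measure, norms, cubes and the kernel on R^n *)

HB.instance Definition _ (R : realType) (n : nat) :=
  Measure_isSigmaFinite.Build _ _ _ (@lebesgue_rV R n)
    (completed_measure_extension_sigma_finite
      (sigma_finiteT (@borel_lebesgue_rV R n))).

Section lebesgue_space.
Context {R : realType} {n : nat}.
Implicit Types (x y : 'rV[R]_n) (r h s : R).

Local Notation T := (caratheodory_type (@borel_lebesgue_rV R n)^*%mu).

Lemma lebesgue_measurable_borel (A : set 'rV[R]_n) :
  measurable A -> lebesgue_measurable A.
Proof. by move=> mA; apply: sub_caratheodory; exact: sub_sigma_algebra. Qed.

Lemma measurable_coord_lebesgue (i : 'I_n) :
  measurable_fun [set: T] (fun x : T => (x : 'rV[R]_n) ord0 i).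
Proof.
move=> _ Y mY; apply: lebesgue_measurable_borel.
exact: (@measurable_coord_rV R n i).
Qed.

Let normr_rVE x : `|x| = \big[Num.max/0]_(ij : 'I_1 * 'I_n) `|x ij.1 ij.2|.
Proof. exact: mx_normrE. Qed.

Lemma normr_rV_lt x h : 0 < h -> (`|x| < h) <-> (forall i, `|x ord0 i| < h).
Proof.
move=> h0; rewrite normr_rVE; split.
  move=> /bigmax_ltP[_ H] i; exact: (H (ord0, i)).
by move=> H; apply/bigmax_ltP; split => // -[i j] _ /=; rewrite ord1.
Qed.

Lemma ler_coord_normr x i : `|x ord0 i| <= `|x|.
Proof.
by rewrite [leRHS]normr_rVE; apply: (le_bigmax _ _ (ord0, i)).
Qed.

Lemma measurable_normr_lebesgue x0 :
  measurable_fun [set: T] (fun x : T => `|(x : 'rV[R]_n) - x0|).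
Proof.
have -> : (fun x : T => `|(x : 'rV[R]_n) - x0|) = fun x : T =>
    \big[Order.max/0%R]_(ij : 'I_1 * 'I_n)
      `|(x : 'rV[R]_n) ij.1 ij.2 - x0 ij.1 ij.2|.
  apply/funext => x; rewrite {1}normr_rVE.
  by apply: eq_bigr => i _; rewrite !mxE.
elim: (index_enum _) => [|ij t IH].
  under eq_fun do rewrite big_nil.
  exact: measurable_cst.
under eq_fun do rewrite big_cons.
have mc : measurable_fun [set: T]
    (fun x : T => (x : 'rV[R]_n) ij.1 ij.2 - x0 ij.1 ij.2).
  rewrite ord1; apply: measurable_funB; first exact: measurable_coord_lebesgue.
  exact: measurable_cst.
exact: measurable_maxr (measurableT_comp (@normr_measurable R setT) mc) IH.
Qed.

Lemma ler_normr_enorm x : `|x| <= enorm x.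
Proof.
rewrite {1}normr_rVE; apply: bigmax_le => [|[i j] _ /=].
  by rewrite /enorm sqrtr_ge0.
rewrite ord1 -sqrtr_sqr /enorm ler_wsqrtr// (bigD1 j)//= lerDl.
by apply: sumr_ge0 => k _; exact: sqr_ge0.
Qed.

Lemma ler_enorm_normr x : enorm x <= n%:R * `|x|.
Proof.
rewrite -[leRHS]ger0_norm ?mulr_ge0// -sqrtr_sqr /enorm ler_wsqrtr//.
apply: (@le_trans _ _ (\sum_(i < n) `|x| ^+ 2)).
  apply: ler_sum => i _; rewrite -real_normK ?num_real//.
  by rewrite lerXn2r ?nnegrE// ler_coord_normr.
rewrite sumr_const card_ord exprMn -[leLHS]mulr_natl ler_wpM2r ?sqr_ge0//.
by rewrite -natrX ler_nat; case: (n) => // k; rewrite expnS expn1 leq_pmulr.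
Qed.

Lemma enorm_ge0 x : 0 <= enorm x. Proof. exact: sqrtr_ge0. Qed.

Definition cube x h : set 'rV[R]_n := [set y | `|y - x| < h].

Lemma measurable_cube x h : lebesgue_measurable (cube x h).
Proof.
have := measurable_normr_lebesgue x measurableT (measurable_itv `]-oo, h[).
by rewrite setTI preimage_itvNyo.
Qed.

Lemma lebesgue_rV_cube x h :
  0 < h -> lebesgue_rV (cube x h) = ((2 * h) ^+ n)%:E.
Proof.
move=> h0.
pose A i : set (measurableTypeR R) := `](x ord0 i - h), (x ord0 i + h)[%classic.
have mA i : measurable (A i) by exact: measurable_itv.
have cubeE : cube x h = [set y | forall i, A i (y ord0 i)].
  apply/seteqP; split => y /=; rewrite /cube /= normr_rV_lt//.
    by move=> + i => /(_ i); rewrite /A/= in_itv/= !mxE -ltr_distl.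
  by move=> + i => /(_ i); rewrite /A/= in_itv/= !mxE -ltr_distl.
(* The completed extension agrees with [borel_lebesgue_rV] on Borel sets, hence the need for Borel
   measurability of the box. *)
have mB : measurable [set y : 'rV[R]_n | forall i, A i (y ord0 i)].
  rewrite (_ : mkset _ = \big[setI/setT]_(i < n)
      ((fun y : 'rV[R]_n => y ord0 i) @^-1` A i)).
    apply: bigsetI_measurable => i _; rewrite -[X in measurable X]setTI.
    exact: (@measurable_coord_rV R n i).
  rewrite -bigcap_seq; apply/seteqP; split => y /= By i.
    by move=> _; exact: By.
  by apply: By; rewrite /= mem_index_enum.
rewrite cubeE /lebesgue_rV /completed_measure_extension measurable_mu_extE//.
apply: etrans (borel_lebesgue_rV_box mA) _.
rewrite (eq_bigr (fun _ => (2 * h)%:E)); last first.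
  move=> i _; apply: etrans (lebesgue_measure_itv _) _ => /=.
  rewrite lte_fin ltrBlDr -addrA ltrDl addr_gt0// -EFinB; congr EFin.
  by ring.
by rewrite prodEFin prodr_const card_ord.
Qed.

(* The summand 1_A x * 1_B y / enorm (x - y) `^ (n + s) of [interaction] is
   convertible to 1_A x * 1_B y * riesz_kernel s (x, y); the kernel vanishes on
   the diagonal, as division by 0 gives 0. *)
Definition riesz_kernel s (z : T * T) : R :=
  (enorm ((z.1 : 'rV[R]_n) - z.2) `^ (n%:R + s))^-1.

Lemma riesz_kernel_ge0 s (z : T * T) : 0 <= riesz_kernel s z.
Proof. by rewrite invr_ge0 powR_ge0. Qed.

Lemma measurable_riesz_kernel s : measurable_fun setT (riesz_kernel s).
Proof.
(* Absorbing the square root into the exponent leaves a real power of a polynomial in the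
   coordinates; the identity holds on the diagonal too. *)
rewrite (_ : riesz_kernel s = fun z : T * T =>
  (\sum_(i < n) ((z.1 : 'rV[R]_n) ord0 i - (z.2 : 'rV[R]_n) ord0 i) ^+ 2)
    `^ (- (2^-1 * (n%:R + s)))); last first.
  apply/funext => z; rewrite powRN powRrM powR12_sqrt; last first.
    by apply: sumr_ge0 => i _; exact: sqr_ge0.
  rewrite /riesz_kernel /enorm; congr ((Num.sqrt _ `^ _)^-1).
  by apply: eq_bigr => i _; rewrite !mxE.
apply: (measurableT_comp (measurable_powR _)).
apply: measurable_sum => i; apply: measurable_funX; apply: measurable_funB.
  exact: (measurableT_comp (measurable_coord_lebesgue i) measurable_fst).
exact: (measurableT_comp (measurable_coord_lebesgue i) measurable_snd).
Qed.

End lebesgue_space.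

(** * Dyadic shells and general integral bounds *)

Lemma dyadic_shell (R : realType) (d t : R) : 0 < d -> d <= t ->
  exists k, d * 2 ^+ k <= t < d * 2 ^+ k.+1.
Proof.
move=> d0 dt.
have [m tm] : exists m, t < d * 2 ^+ m.
  exists (Num.bound (t / d)); rewrite -ltr_pdivrMl// mulrC.
  exact: upper_nthrootP.
(* The least such [m] is not 0 because [d <= t], and its predecessor indexes the shell. *)
case: (ex_minnP (ex_intro (fun m => t < d * 2 ^+ m) m tm)) => -[|k] tk mink.
  by move: tk; rewrite expr0 mulr1 ltNge dt.
exists k; rewrite tk andbT leNgt; apply/negP => /mink.
by rewrite ltnn.
Qed.

Lemma dyadic_shell_inner (R : realType) (d t : R) : 0 < t -> t < d ->
  exists k, d / 2 ^+ k.+1 <= t < d / 2 ^+ k.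
Proof.
move=> t0 td; have p2 k : 0 < 2 ^+ k :> R by rewrite exprn_gt0.
have [m tm] : exists m, d / 2 ^+ m <= t.
  exists (Num.bound (d / t)); rewrite ler_pdivrMr// -ler_pdivrMl// mulrC ltW//.
  exact: upper_nthrootP.
case: (ex_minnP (ex_intro (fun m => d / 2 ^+ m <= t) m tm)) => -[|k] tk mink.
  by move: tk; rewrite expr0 divr1 leNgt td.
exists k; rewrite tk /= ltNge; apply/negP => /mink.
by rewrite ltnn.
Qed.

Section integral_bounds.
Context d (T : measurableType d) (R : realType).
Variable mu : {measure set T -> \bar R}.

Let integral_scaled_indic (c : R) (A : set T) : measurable A -> 0 <= c ->
  (\int[mu]_y (c * \1_A y)%:E = c%:E * mu A)%E.
Proof.
move=> mA c0; under eq_integral do rewrite EFinM.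
rewrite ge0_integralZl_EFin//; last first.
  by apply/measurable_EFinP; exact: measurable_indic.
by rewrite integral_indic// setIT.
Qed.

Lemma integral_split_indic (f : T -> R) (A : set T) :
  measurable A -> measurable_fun setT f -> (forall y, 0 <= f y) ->
  (\int[mu]_y (f y)%:E =
   \int[mu]_y (f y * \1_(~` A) y)%:E + \int[mu]_y (f y * \1_A y)%:E)%E.
Proof.
move=> mA mf f0; rewrite -ge0_integralD//; last 4 first.
- by move=> y _; rewrite lee_fin mulr_ge0.
- apply/measurable_EFinP; apply: measurable_funM => //.
  by apply: measurable_indic; exact: measurableC.
- by move=> y _; rewrite lee_fin mulr_ge0.
- by apply/measurable_EFinP; apply: measurable_funM.
apply: eq_integral => y _; rewrite -EFinD -mulrDr !indicE in_setC; congr EFin.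
by case: (y \in A); rewrite ?addr0 ?add0r mulr1.
Qed.

(** Each [y] with [0 < f y] lies in some [Q k] with [f y <= c k], so the series of the
    [c k * \1_(Q k)] dominates [f]; termwise integration leaves a geometric series. Zeros of [f]
    need not be covered, which later excuses the centre of the shells. *)
Lemma integral_le_geometric (f : T -> R) (Q : nat -> set T) (c : nat -> R)
    (a q : R) :
  measurable_fun setT f -> (forall y, 0 <= f y) ->
  (forall k, measurable (Q k)) -> (forall k, 0 <= c k) ->
  0 <= a -> 0 < q < 1 ->
  (forall k, ((c k)%:E * mu (Q k) <= (a * q ^+ k)%:E)%E) ->
  (forall y, 0 < f y -> exists2 k, Q k y & f y <= c k) ->
  (\int[mu]_y (f y)%:E <= (a / (1 - q))%:E)%E.
Proof.
move=> mf f0 mQ c0 a0 /andP[q0 q1] cQ fc.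
pose g k y := (c k * \1_(Q k) y)%:E.
have mg k : measurable_fun setT (g k).
  by apply/measurable_EFinP; apply: measurable_funM.
have g0 k y : (0 <= g k y)%E by rewrite lee_fin mulr_ge0.
apply: (@le_trans _ _ (\int[mu]_y \sum_(k <oo) g k y)%E).
  apply: ge0_le_integral => //.
  - by move=> y _; rewrite lee_fin.
  - exact/measurable_EFinP.
  - exact: ge0_emeasurable_sum.
  move=> y _; have := f0 y; rewrite le_eqVlt => /predU1P[<-|/fc[k yk fk]].
    exact: nneseries_ge0.
  apply: le_trans (nneseries_lim_ge k.+1 _) => //.
  rewrite big_nat_recr//=; apply: (@le_trans _ _ (g k y)).
    by rewrite /g indicE mem_set ?mulr1 ?lee_fin.
  by rewrite leeDr//; apply: sume_ge0.
rewrite integral_nneseries//.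
apply: lime_le; first by apply: is_cvg_nneseries => k _ _; exact: integral_ge0.
apply: nearW => N.
apply: (@le_trans _ _ (\sum_(0 <= k < N) (a * q ^+ k)%:E)%E).
  by apply: lee_sum => k _; rewrite /g integral_scaled_indic.
rewrite sumEFin lee_fin.
by apply: geometric_le_lim => //; rewrite ger0_norm// ltW.
Qed.

(** [A] has at most half the measure of [Q], so a part of [Q] of measure at least [v / 2] lies
    outside [A], where [g] is at least [c]. *)
Lemma integral_setC_ge (g : T -> R) (A Q : set T) (c v : R) :
  measurable A -> measurable Q -> measurable_fun setT g ->
  (forall y, 0 <= g y) -> 0 <= c -> (mu A <= (v / 2)%:E)%E -> mu Q = v%:E ->
  (forall y, Q y -> ~ A y -> c <= g y) ->
  ((c * (v / 2))%:E <= \int[mu]_y (\1_(~` A) y * g y)%:E)%E.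
Proof.
move=> mA mQ mg g0 c0 Av Qv cg.
have mB : measurable (Q `\` A) by exact: measurableD.
have Bv : ((v / 2)%:E <= mu (Q `\` A))%E.
  have : (v%:E <= mu (Q `\` A) + (v / 2)%:E)%E.
    rewrite -Qv; apply: (@le_trans _ _ (mu ((Q `\` A) `|` A))).
      apply: le_measure; rewrite ?inE//; first exact: measurableU.
      by move=> y yQ; have [Ay|nAy] := pselect (A y); [right|left].
    by apply: le_trans (measureU2 _ mB mA) _; exact: leeD.
  rewrite -leeBlDr// -EFinB; apply: le_trans; rewrite lee_fin.
  lra.
apply: (@le_trans _ _ (c%:E * mu (Q `\` A))%E).
  by rewrite EFinM lee_wpmul2l// lee_fin.
rewrite -integral_scaled_indic//; apply: ge0_le_integral => //.
- by move=> y _; rewrite lee_fin mulr_ge0.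
- by apply/measurable_EFinP; apply: measurable_funM.
- apply/measurable_EFinP; apply: measurable_funM => //.
  by apply: measurable_indic; exact: measurableC.
move=> y _; rewrite lee_fin indicE; case: (boolP (y \in _)); last first.
  by rewrite mulr0 mulr_ge0.
rewrite inE => -[yQ nAy]; rewrite mulr1 indicE mem_set// mul1r.
exact: cg.
Qed.

End integral_bounds.

(** * Upper and lower bounds for integrals of the Riesz kernel *)

Section riesz_bounds.
Context {R : realType} {n : nat}.
Implicit Types (x y : 'rV[R]_n) (h s : R).
Local Notation T := (caratheodory_type (@borel_lebesgue_rV R n)^*%mu).

Lemma integral_le_cube_series (f : T -> R) x (c r : nat -> R) (a q : R) :
  measurable_fun setT f -> (forall y, 0 <= f y) ->
  (forall k, 0 <= c k) -> (forall k, 0 < r k) -> 0 <= a -> 0 < q < 1 ->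
  (forall k, c k * (2 * r k) ^+ n <= a * q ^+ k) ->
  (forall y, 0 < f y -> exists2 k, `|y - x| < r k & f y <= c k) ->
  (\int[@lebesgue_rV R n]_y (f y)%:E <= (a / (1 - q))%:E)%E.
Proof.
move=> mf f0 c0 r0 a0 q01 crn fc.
apply: (@integral_le_geometric _ _ _ _ f (fun k => cube x (r k)) c).
- exact: mf.
- exact: f0.
- by move=> k; exact: measurable_cube.
- exact: c0.
- exact: a0.
- exact: q01.
- move=> k; apply: (@le_trans _ _ ((c k)%:E * ((2 * r k) ^+ n)%:E)%E).
    by rewrite -(lebesgue_rV_cube x (r0 k)); exact: lexx.
  by rewrite -EFinM lee_fin.
- exact: fc.
Qed.

(** The sup norm is the smaller one, so a sup distance of at least [u] forces a Euclidean distance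
    of at least [u]. *)
Lemma riesz_kernel_le s x y u : 0 < n%:R + s -> 0 < u -> u <= `|y - x| ->
  riesz_kernel s ((x, y) : T * T) <= u `^ (- (n%:R + s)).
Proof.
move=> p0 u0 ux; have ue : u <= enorm (x - y).
  by apply: le_trans ux _; rewrite distrC ler_normr_enorm.
rewrite /riesz_kernel/= powRN lef_pV2 ?posrE ?powR_gt0//; last first.
  exact: lt_le_trans ue.
by apply: ge0_ler_powR; rewrite ?nnegrE ?enorm_ge0// ltW.
Qed.

(** [4 * u] is the side of the cube of half-side [2 * u], which contains the shell between the sup
    distances [u] and [2 * u]; its volume cancels the dimension in the exponent. *)
Lemma powRN_cube s (u : R) : 0 < u ->
  u `^ (- (n%:R + s)) * (4 * u) ^+ n = 4 ^+ n * u `^ (- s).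
Proof.
move=> u0; rewrite exprMn -(powR_mulrn n (ltW u0)) mulrCA -powRD; last first.
  by rewrite (gt_eqF u0) implybT.
by congr (_ * _ `^ _); ring.
Qed.

(** On far shells the minimum is at most [d], and the masses decay with ratio [2^-s], which is below
    1 since [0 < s]. *)
Lemma outer_shell_mass s (d : R) k : 0 < d ->
  d * (d * 2 ^+ k) `^ (- (n%:R + s)) * (2 * (2 * (d * 2 ^+ k))) ^+ n =
  4 ^+ n * d `^ (1 - s) * (2 `^ (- s)) ^+ k.
Proof.
move=> d0; set u := d * 2 ^+ k.
have u0 : 0 < u by rewrite mulr_gt0// exprn_gt0.
have -> : 2 * (2 * u) = 4 * u by ring.
rewrite -mulrA powRN_cube// /u powRM ?exprn_ge0 ?ltW//.
rewrite [d `^ (1 - s)]powRD; last by rewrite (gt_eqF d0) implybT.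
rewrite powRr1 ?(ltW d0)// -[2 ^+ k]powR_mulrn//.
rewrite -[(2 `^ (- s)) ^+ k]powR_mulrn ?powR_ge0//.
rewrite -!powRrM (mulrC k%:R); ring.
Qed.

(** On near shells the minimum is at most [2 * u]; this extra factor turns the exponent [-s] into
    [1 - s], so the masses decay as [s < 1]. The inequality comes from lowering the power [k.+1] to
    [k]. *)
Lemma inner_shell_mass s (d : R) k : 0 < d -> s < 1 ->
  2 * (d / 2 ^+ k.+1) * (d / 2 ^+ k.+1) `^ (- (n%:R + s)) *
    (2 * (2 * (d / 2 ^+ k.+1))) ^+ n <=
  2 * 4 ^+ n * d `^ (1 - s) * (2 `^ (- (1 - s))) ^+ k.
Proof.
move=> d0 s1; set u := d / 2 ^+ k.+1.
have u0 : 0 < u by rewrite divr_gt0// exprn_gt0.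
have -> : 2 * (2 * u) = 4 * u by ring.
rewrite -mulrA powRN_cube//.
have -> : 2 * u * (4 ^+ n * u `^ (- s)) = 2 * 4 ^+ n * u `^ (1 - s).
  rewrite powRD; last by rewrite (gt_eqF u0) implybT.
  by rewrite (powRr1 (ltW u0)); ring.
rewrite -!mulrA ler_wpM2l// ler_wpM2l ?exprn_ge0// /u.
rewrite powRM ?invr_ge0 ?exprn_ge0 ?(ltW d0)//.
apply: ler_wpM2l; first exact: powR_ge0.
rewrite -[_ ^+ k]powR_mulrn ?powR_ge0// -[2 ^+ k.+1]powR_mulrn// -powRN.
rewrite -!powRrM.
apply: ler_powR; first by rewrite ler1n.
rewrite !mulNr lerN2 mulrC ler_wpM2r ?subr_ge0 ?(ltW s1)//.
by rewrite ler_nat.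
Qed.

Lemma truncated_riesz_potential_le s : 0 < s < 1 ->
  exists2 C : R, 0 < C & forall x d, 0 < d ->
    (\int[@lebesgue_rV R n]_y
       (Num.min d `|y - x| * riesz_kernel s ((x, y) : T * T))%:E
     <= (C * d `^ (1 - s))%:E)%E.
Proof.
move=> /andP[s0 s1].
pose q1 : R := 2 `^ (- s); pose q2 : R := 2 `^ (- (1 - s)).
have qlt (p : R) : 0 < p -> 0 < (2 : R) `^ (- p) < 1.
  move=> p0; rewrite powR_gt0//= powRN invf_lt1 ?powR_gt0//.
  have := @gt0_ltr_powR R p p0 1 2; rewrite powR1 !nnegrE; apply => //.
  by rewrite ltr1n.
have q1P : 0 < q1 < 1 by exact: qlt.
have q2P : 0 < q2 < 1 by apply: qlt; rewrite subr_gt0.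
have q1d : 0 < 1 - q1 by rewrite subr_gt0; case/andP: q1P.
have q2d : 0 < 1 - q2 by rewrite subr_gt0; case/andP: q2P.
have p0 : 0 < n%:R + s by rewrite ltr_wpDl.
have d4 : 0 < 4 ^+ n :> R by rewrite exprn_gt0.
exists (4 ^+ n / (1 - q1) + 2 * 4 ^+ n / (1 - q2)).
  by rewrite addr_gt0// divr_gt0// mulr_gt0.
move=> x d d0.
pose f (y : T) := Num.min d `|y - x| * riesz_kernel s ((x, y) : T * T).
have f0 y : 0 <= f y by rewrite mulr_ge0 ?riesz_kernel_ge0// le_min ltW/=.
have mf : measurable_fun setT f.
  apply: measurable_funM.
    exact: (measurable_minr (measurable_cst d) (measurable_normr_lebesgue x)).
  exact: (measurableT_comp (measurable_riesz_kernel s) (pair1_measurable _)).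
have mB : measurable (cube x d : set T) by exact: measurable_cube.
have mBC : measurable (~` (cube x d) : set T) by exact: measurableC.
have mfI (A : set T) : measurable A ->
    measurable_fun (setT : set T) (fun y : T => f y * \1_A y).
  by move=> mA; apply: measurable_funM => //; exact: measurable_indic.
have fI0 (A : set T) y : 0 <= f y * \1_A y by rewrite mulr_ge0.
have e0 k : 0 < 2 ^+ k :> R by rewrite exprn_gt0.
(* The far part, outside the cube of half-side [d], comes first and the near part second. *)
rewrite (integral_split_indic _ mB mf f0) mulrDl EFinD; apply: leeD.
  pose u k : R := d * 2 ^+ k.
  have u0 k : 0 < u k by rewrite mulr_gt0.
  rewrite [X in X%:E](_ : _ = (4 ^+ n * d `^ (1 - s)) / (1 - q1)); last first.
    by rewrite mulrAC.
  apply: (@integral_le_cube_series _ x (fun k => d * u k `^ (- (n%:R + s)))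
    (fun k => 2 * u k)).
  - exact: mfI.
  - exact: fI0.
  - by move=> k; rewrite mulr_ge0 ?powR_ge0// ltW.
  - by move=> k; rewrite mulr_gt0.
  - by rewrite mulr_ge0 ?powR_ge0// ltW.
  - exact: q1P.
  - by move=> k; rewrite outer_shell_mass.
  move=> y; rewrite indicE; case: (boolP (_ \in _)); last by rewrite mulr0 ltxx.
  rewrite inE /cube/= mulr1 => /negP; rewrite -leNgt => dy _.
  have [k /andP[k1 k2]] := dyadic_shell d0 dy.
  exists k; first by rewrite /u mulrCA -exprS.
  apply: ler_pM.
  - by rewrite le_min normr_ge0 ltW.
  - exact: riesz_kernel_ge0.
  - by rewrite ge_min lexx.
  - exact: riesz_kernel_le.
pose u k : R := d / 2 ^+ k.+1.
have u0 k : 0 < u k by rewrite divr_gt0.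
rewrite [X in X%:E](_ : _ = (2 * 4 ^+ n * d `^ (1 - s)) / (1 - q2)); last first.
  by rewrite mulrAC.
apply: (@integral_le_cube_series _ x (fun k => 2 * u k * u k `^ (- (n%:R + s)))
  (fun k => 2 * u k)).
- exact: mfI.
- exact: fI0.
- by move=> k; rewrite !mulr_ge0 ?powR_ge0// ltW.
- by move=> k; rewrite mulr_gt0.
- by rewrite !mulr_ge0 ?powR_ge0// ltW.
- exact: q2P.
- by move=> k; exact: inner_shell_mass.
move=> y; rewrite indicE; case: (boolP (_ \in _)); last by rewrite mulr0 ltxx.
rewrite inE /cube/= mulr1 => yd fy.
(* The centre lies in no shell, but the minimum vanishes there, so [0 < f y] excludes it. *)
have y0 : 0 < `|y - x|.
  rewrite lt_def normr_ge0 andbT; apply: contraTneq fy => yx.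
  by rewrite /f yx min_r ?mul0r ?ltxx// ltW.
have [k /andP[k1 k2]] := dyadic_shell_inner y0 yd.
have uE : 2 * u k = d / 2 ^+ k.
  by rewrite /u exprS invfM mulrCA mulVKf.
exists k; first by rewrite uE.
apply: ler_pM.
- by rewrite le_min normr_ge0 ltW.
- exact: riesz_kernel_ge0.
- by rewrite ge_min uE (ltW k2) orbT.
- exact: riesz_kernel_le.
Qed.

(** At least half of the cube of half-side [h] around [x] lies outside [A], at Euclidean distance
    less than [n * h] from [x]. *)
Lemma riesz_potential_setC_ge s x h (A : set T) : (0 < n)%N -> 0 < s -> 0 < h ->
  measurable A -> A x -> (@lebesgue_rV R n A <= ((2 * h) ^+ n / 2)%:E)%E ->
  (((n%:R * h) `^ (- (n%:R + s)) * ((2 * h) ^+ n / 2))%:E <=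
    \int[@lebesgue_rV R n]_y
      (\1_(~` A) y * riesz_kernel s ((x, y) : T * T))%:E)%E.
Proof.
move=> n0 s0 h0 mA Ax Ah.
have p0 : 0 < n%:R + s by rewrite ltr_wpDl.
have mQ : measurable (cube x h : set T) by exact: measurable_cube.
apply: (@integral_setC_ge _ _ _ _ _ A (cube x h)).
- exact: mA.
- exact: mQ.
- exact: (measurableT_comp (measurable_riesz_kernel s) (pair1_measurable _)).
- by move=> y; exact: riesz_kernel_ge0.
- exact: powR_ge0.
- exact: Ah.
- exact: lebesgue_rV_cube.
move=> y yQ nAy.
(* [A x] keeps [y] off [x], where the kernel takes its default value 0 and the lower bound would
   fail. *)
have xy : x - y != 0 by rewrite subr_eq0; apply: contra_notN nAy => /eqP <-.
have e0 : 0 < enorm (x - y).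
  by apply: lt_le_trans (ler_normr_enorm _); rewrite normr_gt0.
rewrite /riesz_kernel/= powRN lef_pV2 ?posrE ?powR_gt0// ?mulr_gt0 ?ltr0n//.
apply: ge0_ler_powR; rewrite ?nnegrE ?ltW// ?mulr_gt0 ?ltr0n//.
apply: le_lt_trans (ler_enorm_normr _) _.
by rewrite ltr_pM2l ?ltr0n// distrC.
Qed.

End riesz_bounds.

(** * Decay between two radii and its iteration down to a null cube *)

Lemma subsolution_decay (R : realType) (n : nat) (s : R) :
  (0 < n)%N -> 0 < s < 1 ->
  exists2 eta : R, 0 < eta &
    forall (Omega E : set 'rV[R]_n) x0 a b,
      lebesgue_measurable E -> variational_subsolution s Omega E -> a < b ->
      E `&` cube x0 b `<=` Omega ->
      (lebesgue_rV (E `&` cube x0 b) <=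
        ((2 * (eta * (b - a))) ^+ n / 2)%:E)%E ->
      (lebesgue_rV (E `&` cube x0 a) <=
        ((2 ^+ n)^-1)%:E * lebesgue_rV (E `&` cube x0 b))%E.
Proof.
move=> n0 hs; have [C C0 upper] := @truncated_riesz_potential_le R n s hs.
have /andP[s0 s1] := hs.
have nR : 0 < n%:R :> R by rewrite ltr0n.
pose p := n%:R + s; have p0 : 0 < p by rewrite addr_gt0.
(* With [eta^s = w], the energy constants satisfy [2 * M = 2^-n * (d * m)] exactly ([dmM] below).
   Both sides scale like [d^(1 - s)], so [eta] does not depend on the radii. *)
pose w := n%:R `^ (- p) / (4 * C).
have w0 : 0 < w by rewrite divr_gt0 ?powR_gt0// mulr_gt0.
pose eta := w `^ s^-1; have eta0 : 0 < eta by exact: powR_gt0.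
have etaS : eta `^ s = w by rewrite /eta -powRrM mulVf ?gt_eqF// powRr1// ltW.
exists eta => // Omega E x0 a b mE sub ab EO small.
set d := b - a; have d0 : 0 < d by rewrite subr_gt0.
pose h := eta * d; have h0 : 0 < h by rewrite mulr_gt0.
pose m := (n%:R * h) `^ (- p) * ((2 * h) ^+ n / 2).
have m0 : 0 < m by rewrite mulr_gt0 ?powR_gt0 ?divr_gt0 ?exprn_gt0 ?mulr_gt0.
pose M := C * d `^ (1 - s).
have dmM : 2 * M = (2 ^+ n)^-1 * (d * m).
  have hp : h `^ (- p) * h ^+ n = (w `^ -1) * d `^ (- s).
    rewrite -(powR_mulrn n (ltW h0)) -powRD; last first.
      by rewrite (gt_eqF h0) implybT.
    rewrite (_ : - p + n%:R = - s); last by rewrite /p; ring.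
    rewrite powRM ?ltW// powRN etaS powR_inv1//; exact: ltW.
  have -> : m = n%:R `^ (- p) * 2 ^+ n / 2 * (h `^ (- p) * h ^+ n).
    by rewrite /m powRM ?ltW// exprMn; ring.
  rewrite hp powR_inv1 ?(ltW w0)// /M /w powRD; last first.
    by rewrite (gt_eqF d0) implybT.
  rewrite powRr1 ?(ltW d0)//; field.
  by rewrite !gt_eqF ?powR_gt0// exprn_gt0.
have avg : (((b - a) * m)%:E * lebesgue_rV (E `&` cube x0 a) <=
    (2 * M)%:E * lebesgue_rV (E `&` cube x0 b))%E.
  apply: (@averaged_energy_le _ _ R (@lebesgue_rV R n) (@riesz_kernel R n s)
    (fun y => `|(y : 'rV[R]_n) - x0|) E (measurable_riesz_kernel s)
    (@riesz_kernel_ge0 R n s) (measurable_normr_lebesgue x0) mE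
    (fun x y => `|(y : 'rV[R]_n) - x|) a b m M ab (ltW m0)).
  - by rewrite mulr_ge0 ?powR_ge0// ltW.
  - exact: measurable_normr_lebesgue.
  - move=> x y; rewrite ge_max normr_ge0/= lerBlDr.
    by have := ler_normD ((y : 'rV[R]_n) - x) (x - x0); rewrite subrKA.
  - move=> t /andP[at_ tb]; apply: sub.
      exact: (measurableI _ _ mE (measurable_cube x0 t)).
    move=> y [Ey yt]; split => //; apply: EO; split => //.
    exact: lt_trans yt tb.
  - move=> t /andP[at_ tb] x xt.
    apply: riesz_potential_setC_ge => //.
      exact: (measurableI _ _ mE (measurable_cube x0 t)).
    (* Smallness at radius [b] passes to every [t < b], which gives the half-volume condition for
       the cube of half-side [h]. *)
    apply: le_trans small; apply: le_mu_ext => y [Ey yt]; split => //.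
    exact: lt_trans yt tb.
  - by move=> x; exact: upper.
have dm0 : 0 < d * m by rewrite mulr_gt0.
move: avg; rewrite dmM (mulrC _ (d * m)) (EFinM (d * m) (2 ^+ n)^-1) -muleA.
by rewrite lee_pmul2l// lte_fin.
Qed.

(** Otherwise the open cube would contain a point [y] of [E]. A Euclidean ball around [y] inside the
    cube meets [E] in a null set, so [y] is in the measure-theoretic interior of the complement,
    which normalization forbids. *)
Lemma null_cube_notin_closure (R : realType) (n : nat) (E : set 'rV[R]_n) x h :
  mt_normalized E -> 0 < h -> lebesgue_rV (E `&` cube x h) = 0%E ->
  ~ closure E x.
Proof.
move=> [_ Enorm] h0 Eh clE.
have [|y [Ey yh]] := clE (cube x h).
  have := nbhsx_ballx x h h0; rewrite mx_norm_ball /ball_ /cube.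
  by under eq_set do rewrite distrC.
suff : (mt_interior (~` E) `&` E) y by rewrite Enorm.
split => //; exists (h - `|y - x|); first by rewrite subr_gt0.
apply/eqP; rewrite eq_le measure_ge0 andbT -[leRHS]Eh.
apply: le_mu_ext => z [zy /contrapT Ez]; split => //.
rewrite /cube/= -(subrKA y z (- x)); apply: le_lt_trans (ler_normD _ _) _.
by rewrite -ltrBrDr; apply: le_lt_trans (ler_normr_enorm _) zy.
Qed.

Theorem theorem4p1 (R : realType) (n : nat) (s : R) (hn : (1 <= n)%N)
    (hs : 0 < s < 1) :
  exists2 c : R, 0 < c &
    forall (Omega E : set 'rV[R]_n) (x : 'rV[R]_n) (r : R),
      lebesgue_measurable Omega -> bounded_set Omega ->
      lebesgue_measurable E -> mt_normalized E ->
      variational_subsolution s Omega E ->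
      boundary E x -> 0 < r -> eball x r `&` E `<=` Omega ->
      ((c * r ^+ n)%:E <= lebesgue_rV (E `&` eball x r))%E.
Proof.
have [eta eta0 decay] := subsolution_decay hn hs.
have nR : 0 < n%:R :> R by rewrite ltr0n.
(* Chosen so that [c * r^n] is the first threshold [v 0] below, where [delta 0 = rho / 4] and
   [rho = r / n]. *)
exists ((eta / (2 * n%:R)) ^+ n / 2).
  by rewrite divr_gt0// exprn_gt0// divr_gt0// mulr_gt0.
move=> Omega E x r _ _ mE normE subE [clE _] r0 EO.
rewrite leNgt; apply/negP => small.
pose rho := r / n%:R; have rho0 : 0 < rho by rewrite divr_gt0.
(* The radii decrease from [t 0 = rho] towards [rho / 2], with gaps [delta k] halved at each
   step. *)
pose t k : R := rho / 2 + rho / 2 ^+ k.+1.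
pose delta k : R := rho / 2 ^+ k.+2.
have p2 k : 0 < 2 ^+ k :> R by rewrite exprn_gt0.
have tS k : t k - t k.+1 = delta k.
  by rewrite /t /delta !exprS; field; rewrite gt_eqF.
have delta0 k : 0 < delta k by rewrite divr_gt0.
have t_le k : t k <= rho.
  rewrite /t [leRHS]splitr lerD2l ler_pM2l// lef_pV2 ?posrE//.
  by rewrite exprS ler_peMr// exprn_ege1// ler1n.
have cube_eball : cube x rho `<=` eball x r.
  move=> y yx; apply: le_lt_trans (ler_enorm_normr _) _.
  by rewrite mulrC -ltr_pdivlMr.
have EOk k : E `&` cube x (t k) `<=` Omega.
  move=> y [Ey yx]; apply: EO; split => //; apply: cube_eball.
  exact: lt_le_trans yx (t_le k).
pose v k : R := (2 * (eta * delta k)) ^+ n / 2.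
(* Halving the gap multiplies the threshold by [2^-n], exactly the factor gained in [decay], so the
   induction [Ev] closes. *)
have vS k : v k.+1 = (2 ^+ n)^-1 * v k.
  rewrite /v [RHS]mulrA -exprVn -exprMn; congr (_ ^+ n / 2).
  by rewrite /delta (exprS _ k.+2); field; rewrite gt_eqF.
have Ev k : (lebesgue_rV (E `&` cube x (t k)) <= (v k)%:E)%E.
  elim: k => [|k IH].
    apply: le_trans (ltW (lt_le_trans small _)).
      apply: le_mu_ext => y [Ey yx]; split => //; apply: cube_eball.
      exact: lt_le_trans yx (t_le _).
    rewrite lee_fin /v [leLHS]mulrAC ler_wpM2r ?invr_ge0// -exprMn le_eqVlt.
    apply/orP; left; apply/eqP; congr (_ ^+ n).
    by rewrite /delta /rho; field; rewrite gt_eqF.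
  have tk : t k.+1 < t k by rewrite -subr_gt0 tS.
  apply: le_trans (decay Omega E x _ _ mE subE tk (EOk k) _) _.
    by rewrite tS; exact: IH.
  by rewrite vS EFinM; apply: lee_wpmul2l => //; rewrite lee_fin invr_ge0 ltW.
have v0 k : 0 < v k by rewrite divr_gt0// exprn_gt0// mulr_gt0// mulr_gt0.
(* As [1 <= n], each factor [2^-n] is at most one half, so the thresholds tend to 0. *)
have v_le k : v k <= v 0%N / 2 ^+ k.
  elim: k => [|k IH]; first by rewrite expr0 divr1.
  have n2 : (2 ^+ n)^-1 <= 2^-1 :> R.
    by rewrite lef_pV2 ?posrE// -[leLHS]expr1 ler_eXn2l ?ltr1n.
  rewrite vS exprS invfM [leRHS]mulrCA.
  by apply: (ler_pM _ _ n2 IH); rewrite ?invr_ge0 ltW.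
apply: (null_cube_notin_closure (h := rho / 2) normE _ _ clE).
  by rewrite divr_gt0.
(* The cube of half-side [rho / 2] lies in all the cubes of half-side [t k], so its share of [E] is
   below every threshold and hence null. *)
have Ehalf k : (lebesgue_rV (E `&` cube x (rho / 2)) <= (v 0%N / 2 ^+ k)%:E)%E.
  apply: (@le_trans _ _ (v k)%:E); last by rewrite lee_fin.
  apply: le_trans (Ev k); apply: le_mu_ext => y [Ey yx]; split => //.
  by apply: lt_le_trans yx _; rewrite lerDl ltW// divr_gt0.
apply/eqP; rewrite eq_le measure_ge0 andbT; apply/lee_addgt0Pr => e e0.
rewrite add0e; apply: le_trans (Ehalf (Num.bound (v 0%N / e))) _.
rewrite lee_fin ler_pdivrMr// -ler_pdivrMl// mulrC ltW//.
exact: upper_nthrootP.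
Qed.
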